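(* Let $k$ be a positive integer and $n\ge 2k$. The set partitions of $[k]\cup[\overline{k}]$ are in bijection with the pairs $(T,S)$ of standard multiset tableaux satisfying: $T$ and $S$ are of the same shape $\lambda$, where $\lambda$ is a partition of $n$; $T$ has content $[\overline{k}]$; and $S$ has content $[k]$.
   Context: $[k]=\{1,\ldots,k\}$ and $[\overline{k}]=\{\overline1,\ldots,\overline{k}\}$ are two disjoint sets, ordered by $1<\cdots<k$ and $\overline1<\cdots<\overline{k}$. A set partition of a set is a collection of non-empty, pairwise disjoint subsets (blocks) whose union is the set. Last letter order on disjoint sets: for disjoint non-empty subsets $X,Y$ of $[k]$ (or of $[\overline k]$), $X<Y$ if $\max(X)<\max(Y)$; the empty set is smaller than every non-empty set (and equal to itself). The diagram of a partition $\lambda=(\lambda_1\ge\cdots\ge\lambda_r>0)$ has $\lambda_j$ left-justified cells in row $j$. A standard multiset tableau of shape $\lambda$ and content $[k]$ is a filling of the cells of $\lambda$ by subsets of $[k]$, the empty set being allowed to label several cells, such that every letter of $[k]$ lies in exactly one entry, entries weakly increase (in last letter order) along each row from left to right, and entries strictly increase in each column when passing from row $j$ to row $j+1$. Standard multiset tableaux of content $[\overline{k}]$ are defined in the same way with $[\overline{k}]$ in place of $[k]$. *)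

(* Defs.v *)
From mathcomp Require Import all_boot.

Set Implicit Arguments.
Unset Strict Implicit.
Unset Printing Implicit Defensive.

(* The elements of [k] and of its disjoint copy [k-bar], numbered from 0:
   [inl i] stands for the letter i+1 and [inr i] for the barred letter i+1. *)
Definition letter (k : nat) : finType := ('I_k + 'I_k)%type.

Definition unbarred (k : nat) : {set letter k} := [set inl i | i : 'I_k].

Definition barred (k : nat) : {set letter k} := [set inr i | i : 'I_k].

(* Position of a letter in its own alphabet; only letters of the same alphabet
   are meant to be compared. *)
Definition letter_pos (k : nat) (a : letter k) : nat :=
  match a with inl i => nat_of_ord i | inr i => nat_of_ord i end.

(* Meaningful only for nonempty X, since the big max of the empty range is 0,
   which is also the position of the first letter. *)
Definition max_pos (k : nat) (X : {set letter k}) : nat :=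
  \max_(a in X) letter_pos a.

(* Last letter order. *)
Definition last_lt (k : nat) (X Y : {set letter k}) : bool :=
  (Y != set0) && ((X == set0) || (max_pos X < max_pos Y)).

Definition last_le (k : nat) (X Y : {set letter k}) : bool :=
  (X == Y) || last_lt X Y.

Definition is_intpart (lam : seq nat) : bool :=
  sorted geq lam && all (leq 1) lam.

(* A filling is given by its sequence of rows, from row 1 on. *)
Definition filling (k : nat) : Type := seq (seq {set letter k}).

(* As row lengths decrease, [zip] pairs each cell of the lower-indexed row [r1]
   having a neighbour in the next row [r2] with that neighbour. *)
Definition column_lt (k : nat) (r1 r2 : seq {set letter k}) : bool :=
  all (fun p => last_lt p.1 p.2) (zip r1 r2).

(* Standard multiset tableaux of content C; the occurrence of a letter in
   exactly one entry is counted over cells, so that a repeated nonempty entry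
   is excluded. *)
Definition std_mset_tableau (k : nat) (C : {set letter k}) (T : filling k)
    : bool :=
  [&& is_intpart (shape T),
      all (fun X : {set letter k} => X \subset C) (flatten T),
      [forall a in C,
         count (fun X : {set letter k} => a \in X) (flatten T) == 1],
      all (sorted (@last_le k)) T
    & sorted (@column_lt k) T].

Definition set_partition (k : nat) : Type :=
  {P : {set {set letter k}} | partition P (unbarred k :|: barred k)}.

Definition tableau_pair (k n : nat) : Type :=
  {TS : filling k * filling k |
     [&& shape TS.1 == shape TS.2,
         sumn (shape TS.1) == n,
         std_mset_tableau (barred k) TS.1
       & std_mset_tableau (unbarred k) TS.2]}.

(* Main.v *)
Require Import Defs.
From mathcomp Require Import all_boot zify.

Set Implicit Arguments.
Unset Strict Implicit.
Unset Printing Implicit Defensive.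

(** Both sides are finite and are counted by the same double sum.

    Restricting a set partition R of the two alphabets to each of them gives a
    set partition P of the unbarred letters and a set partition Q of the barred
    ones; R is recovered from P, Q and the partial matching that tells which
    blocks of P are glued to which blocks of Q.  So the set partitions are
    counted by the sum over P and Q of the number [npinj #|P| #|Q|] of partial
    injections between the blocks ([card_partitions_disjointU]).

    The nonempty entries of a standard multiset tableau with n cells are the
    blocks of a set partition Q of its content, and its empty entries fill the
    beginning of the first row.  Adding the blocks one by one, in last letter
    order, to the row of n - #|Q| empty sets, each at the end of some row,
    turns the tableau into a saturated chain of Young's lattice that goes from
    the one-row partition (n - #|Q|) to the shape ([mem_tabs], [shape_tabs]).
    Let U be the operator that adds a cell in all possible ways, and D the one
    that removes a cell; they are adjoint.  The pairs of tableaux of equal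
    shape with p and q blocks are counted by the scalar product of
    U^p (n - p) and U^q (n - q).

    Since D U = U D + 1 ([sum_downs_ups]) and D (m + 1) = (m), moving one U
    across this product shows that it satisfies the recursion of [npinj], as
    long as p + q <= n ([dotp_rows]); as p and q are at most k, this is what
    the hypothesis 2 k <= n guarantees.  This replaces the insertion algorithm
    by its counting version, and a bijection is then read off from two
    enumerations of the same length. *)

(** * Young's lattice *)

(** Reading rows beyond the last one as 0 makes the monotonicity condition
    uniform in the row index, which is what all arguments below rely on. *)
Lemma intpartP (l : seq nat) :
  reflect ((forall i, nth 0 l i.+1 <= nth 0 l i) /\
           (forall i, i < size l -> 0 < nth 0 l i)) (is_intpart l).
Proof.
apply: (iffP andP) => [[/(sortedP 0) le_l /(all_nthP 0) pos_l]|[le_l pos_l]].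
  split=> // i; have [lt_i|ge_i] := ltnP i.+1 (size l); first exact: le_l.
  by rewrite nth_default.
split; first by apply/(sortedP 0) => i _; apply: le_l.
by apply/(all_nthP 0) => i /pos_l.
Qed.

(** The absence of zero parts makes the representation of a partition by a
    sequence canonical, so that partitions can be compared row by row. *)
Lemma intpart_ext (l l' : seq nat) :
  is_intpart l -> is_intpart l' -> nth 0 l =1 nth 0 l' -> l = l'.
Proof.
move=> /intpartP[_ pos_l] /intpartP[_ pos_l'] eq_nth.
apply: (eq_from_nth (x0 := 0)) => [|i _]; last exact: eq_nth.
apply/eqP; rewrite eqn_leq; apply/andP; split; rewrite leqNgt; apply/negP.
  by move=> /pos_l; rewrite eq_nth nth_default.
by move=> /pos_l'; rewrite -eq_nth nth_default.
Qed.

Lemma intpart_nth_le (l : seq nat) i j :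
  is_intpart l -> i <= j -> nth 0 l j <= nth 0 l i.
Proof.
move=> /intpartP[le_l _] /subnK <-.
by elim: (j - i) => // d IHd; apply: leq_trans (le_l _) IHd.
Qed.

Definition addable (l : seq nat) i := (i == 0) || (nth 0 l i < nth 0 l i.-1).

Definition removable (l : seq nat) i := nth 0 l i.+1 < nth 0 l i.

(** Removing the only cell of a row, necessarily the last one, must shorten the
    sequence. *)
Definition decr_nth (l : seq nat) i :=
  if nth 0 l i == 1 then take i l else set_nth 0 l i (nth 0 l i).-1.

Lemma addable_size l i : addable l i -> i <= size l.
Proof.
case: i => [//|i] /=; rewrite /addable /= => lt_i; rewrite ltnNge; apply/negP.
by move=> le_i; rewrite (nth_default _ le_i) in lt_i.
Qed.

Lemma removable_size l i : removable l i -> i < size l.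
Proof.
rewrite /removable => lt_i; rewrite ltnNge; apply/negP => le_i.
by rewrite (nth_default _ le_i) in lt_i.
Qed.

Lemma incr_intpart l i :
  is_intpart l -> addable l i -> is_intpart (incr_nth l i).
Proof.
move=> /intpartP[le_l pos_l] add_i; have le_i := addable_size add_i.
apply/intpartP; split=> j.
  rewrite !nth_incr_nth; have := le_l j; move: add_i; rewrite /addable.
  by case: (i =P j.+1) => [->|] /=; lia.
rewrite size_incr_nth nth_incr_nth; have := pos_l j.
by case: (ltnP i) => lt_i; case: eqVneq => [<-|]; lia.
Qed.

Lemma nth_decr l i j : is_intpart l -> removable l i ->
  nth 0 (decr_nth l i) j = nth 0 l j - (i == j).
Proof.
move=> part_l rem_i; rewrite /decr_nth; case: eqP => [l_i|_]; last first.
  by rewrite nth_set_nth /= (eq_sym i); case: (j =P i) => [->|]; lia.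
have [lt_ji|le_ij] := ltnP j i; first by rewrite nth_take //; lia.
rewrite nth_default ?size_take; last by case: (ltnP i (size l)); lia.
have := intpart_nth_le part_l le_ij; case: eqVneq => [<-|ne_ij _]; first by lia.
have /(intpart_nth_le part_l): i.+1 <= j by lia.
by move: rem_i; rewrite /removable; lia.
Qed.

Lemma decr_intpart l i :
  is_intpart l -> removable l i -> is_intpart (decr_nth l i).
Proof.
move=> part_l rem_i; have [le_l pos_l] := intpartP _ part_l.
have lt_i := removable_size rem_i.
apply/intpartP; split=> j.
  rewrite !nth_decr //; have := le_l j; move: rem_i; rewrite /removable.
  by case: (i =P j) => [->|] /=; lia.
move=> lt_j; rewrite nth_decr //; move: lt_j; rewrite /decr_nth.
case: eqP => [l_i|ne1].
  by rewrite size_take lt_i => lt_j; have := pos_l j; lia.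
rewrite size_set_nth => lt_j; have := pos_l j; have := pos_l i.
by case: (i =P j) => [<-|]; lia.
Qed.

(** The cover relation of Young's lattice read upwards and downwards; this is
    what makes adding and removing cells adjoint to each other. *)
Lemma incr_nth_eq l m i : is_intpart l -> is_intpart m ->
  (addable l i && (incr_nth l i == m)) =
  (removable m i && (l == decr_nth m i)).
Proof.
move=> part_l part_m; have [le_l _] := intpartP _ part_l.
have [le_m _] := intpartP _ part_m.
apply/andP/andP => -[ok_i /eqP].
  move=> def_m; have rem_i: removable m i.
    rewrite /removable -def_m !nth_incr_nth; have := le_l i; lia.
  split=> //; apply/eqP; apply: intpart_ext => //; first exact: decr_intpart.
  by move=> j; rewrite nth_decr // -def_m nth_incr_nth; lia.
move=> def_l; have nth_l j : nth 0 l j = nth 0 m j - (i == j).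
  by rewrite def_l nth_decr.
have add_i: addable l i.
  case: i ok_i {def_l} nth_l => // i; rewrite /addable /removable /= => ok nth_l.
  by rewrite !nth_l; have := le_m i; lia.
split=> //; apply/eqP; apply: intpart_ext => //; first exact: incr_intpart.
move=> j; rewrite nth_incr_nth nth_l; move: ok_i; rewrite /removable.
by case: eqP => [->|]; lia.
Qed.

Definition ups l := [seq incr_nth l i | i <- iota 0 (size l).+1 & addable l i].

Definition downs l := [seq decr_nth l i | i <- iota 0 (size l) & removable l i].

(** The bound N is free, so that sums over the covers of different partitions
    can be put on a common range of row indices. *)
Lemma sum_ups N l (F : seq nat -> nat) : size l < N ->
  \sum_(x <- ups l) F x = \sum_(i < N | addable l i) F (incr_nth l i).
Proof.
rewrite -(big_mkord (addable l) (fun i => F (incr_nth l i))).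
move=> lt_N; rewrite big_map big_filter /index_iota subn0.
rewrite (_ : N = (size l).+1 + (N - (size l).+1)); last by lia.
rewrite iotaD big_cat /= [X in _ + X]big1_seq ?addn0 // => i /andP[add_i].
by rewrite mem_iota; have := addable_size add_i; lia.
Qed.

Lemma sum_downs N l (F : seq nat -> nat) : size l <= N ->
  \sum_(x <- downs l) F x = \sum_(i < N | removable l i) F (decr_nth l i).
Proof.
rewrite -(big_mkord (removable l) (fun i => F (decr_nth l i))).
move=> lt_N; rewrite big_map big_filter /index_iota subn0.
rewrite (_ : N = size l + (N - size l)); last by lia.
rewrite iotaD big_cat /= [X in _ + X]big1_seq ?addn0 // => i /andP[rem_i].
by rewrite mem_iota; have := removable_size rem_i; lia.
Qed.

Lemma ups_intpart l : is_intpart l -> all is_intpart (ups l).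
Proof.
move=> part_l; apply/allP => _ /mapP[i + ->]; rewrite mem_filter => /andP[add_i _].
exact: incr_intpart.
Qed.

Lemma downs_intpart l : is_intpart l -> all is_intpart (downs l).
Proof.
move=> part_l; apply/allP => _ /mapP[i + ->]; rewrite mem_filter => /andP[rem_i _].
exact: decr_intpart.
Qed.

(** A partition has one more addable row than removable ones: row 0 is always
    addable, and row i.+1 is addable exactly when row i is removable. *)
Lemma sum_addable l (c N : nat) : is_intpart l -> size l < N ->
  \sum_(i < N | addable l i) c = c + \sum_(i < N | removable l i) c.
Proof.
move=> part_l; case: N => // N; rewrite ltnS => le_N.
rewrite big_mkcond big_ord_recl //= [in RHS]big_mkcond big_ord_recr //=.
have -> : removable l N = false by rewrite /removable !nth_default //; lia.
by rewrite addn0.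
Qed.

(** Adding a cell and removing a cell in two different rows do not interfere:
    a condition involving two adjacent rows is the same before and after. *)
Lemma addable_decr l i j : is_intpart l -> i != j ->
  removable l j && addable (decr_nth l j) i =
  addable l i && removable (incr_nth l i) j.
Proof.
move=> part_l ne_ij; have [le_l _] := intpartP _ part_l.
have [rem_j|] := boolP (removable l j); last first.
  rewrite /addable /removable !nth_incr_nth (negbTE ne_ij).
  have := le_l j; case: (i =P j.+1) => [->|]; lia.
rewrite /addable /removable !nth_decr // !nth_incr_nth (negbTE ne_ij).
rewrite (eq_sym j) (negbTE ne_ij) subn0; move: rem_j; rewrite /removable.
case: i ne_ij => [|i] /=; first by lia.
rewrite eqSS; case: (j =P i) => [->|]; lia.
Qed.

Lemma decr_incrC l i j : is_intpart l -> i != j -> addable l i ->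
  removable (incr_nth l i) j ->
  decr_nth (incr_nth l i) j = incr_nth (decr_nth l j) i.
Proof.
move=> part_l ne_ij add_i rem_j.
have /andP[rem_j' add_i']: removable l j && addable (decr_nth l j) i.
  by rewrite addable_decr // add_i.
have part_d := decr_intpart part_l rem_j'.
have part_i := incr_intpart part_l add_i.
apply: intpart_ext; [exact: decr_intpart | exact: incr_intpart |] => h.
rewrite nth_decr // !nth_incr_nth nth_decr //.
by case: (i =P h) ne_ij => [->|]; lia.
Qed.

(** The commutation relation D U = U D + 1.  Moves in different rows commute;
    going up and down in the same row is possible once more often than going
    down and up, by [sum_addable]. *)
Lemma sum_downs_ups l (F : seq nat -> nat) : is_intpart l ->
  \sum_(x <- ups l) \sum_(y <- downs x) F y =
  F l + \sum_(x <- downs l) \sum_(y <- ups x) F y.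
Proof.
move=> part_l; have [le_l pos_l] := intpartP _ part_l.
have [N lt_N]: exists N, (size l).+1 < N by exists (size l).+2.
rewrite (@sum_ups N) ?(@sum_downs N) //; try lia.
(* The move in the same row is split off from each inner sum. *)
have -> : \sum_(i < N | addable l i) \sum_(y <- downs (incr_nth l i)) F y
  = \sum_(i < N | addable l i) (F l + \sum_(j < N |
      removable (incr_nth l i) j && (j != i)) F (decr_nth (incr_nth l i) j)).
  apply: eq_bigr => i add_i; have le_i := addable_size add_i.
  have /andP[rem_i /eqP eq_l] :
    removable (incr_nth l i) i && (l == decr_nth (incr_nth l i) i).
    by rewrite -incr_nth_eq ?add_i ?eqxx //; apply: incr_intpart.
  rewrite (@sum_downs N); last by rewrite size_incr_nth; case: ltnP; lia.
  by rewrite (bigD1 i) //= -eq_l.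
have -> : \sum_(j < N | removable l j) \sum_(y <- ups (decr_nth l j)) F y
  = \sum_(j < N | removable l j) (F l + \sum_(i < N |
      addable (decr_nth l j) i && (i != j)) F (incr_nth (decr_nth l j) i)).
  apply: eq_bigr => i rem_i; have lt_i := removable_size rem_i.
  have part_d := decr_intpart part_l rem_i.
  have /andP[add_i /eqP eq_l] :
    addable (decr_nth l i) i && (incr_nth (decr_nth l i) i == l).
    by rewrite incr_nth_eq ?rem_i ?eqxx.
  rewrite (@sum_ups N); last first.
    rewrite /decr_nth; case: ifP; rewrite ?size_set_nth ?size_take.
      by rewrite lt_i; lia.
    by rewrite (maxn_idPr lt_i); lia.
  by rewrite (bigD1 i) //= eq_l.
rewrite !big_split /= (sum_addable _ part_l); last by lia.
rewrite -addnA; congr (_ + (_ + _)).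
rewrite (exchange_big_dep (fun j : 'I_N => removable l j)) /=; last first.
  move=> i j add_i /andP[rem_j ne_ji].
  have := addable_decr part_l (i := i) (j := j).
  by rewrite eq_sym ne_ji add_i rem_j => /(_ isT) /andP[].
apply: eq_bigr => j rem_j; apply: eq_big => [i|i /and3P[add_i rem_ij ne_ji]].
  rewrite andbA (eq_sym j); case: (altP (i =P j)) => [|ne_ij]; rewrite ?andbF //.
  by rewrite -addable_decr // rem_j.
by rewrite decr_incrC // eq_sym.
Qed.

(** Sequences of partitions stand for formal sums of partitions with natural
    coefficients; U, D and the scalar product for which the partitions are
    orthonormal become [up], [down] and [dotp]. *)
Definition up L := flatten (map ups L).

Definition down L := flatten (map downs L).

Definition dotp (L L' : seq (seq nat)) := \sum_(x <- L) \sum_(y <- L') (x == y).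

Lemma up_intpart L : all is_intpart L -> all is_intpart (up L).
Proof.
move=> /allP part_L; apply/allP => x /flattenP[_ /mapP[l /part_L part_l ->]].
exact/allP/ups_intpart.
Qed.

Lemma down_intpart L : all is_intpart L -> all is_intpart (down L).
Proof.
move=> /allP part_L; apply/allP => x /flattenP[_ /mapP[l /part_L part_l ->]].
exact/allP/downs_intpart.
Qed.

Lemma sum_ups_downs l m : is_intpart l -> is_intpart m ->
  \sum_(x <- ups l) (x == m) = \sum_(y <- downs m) (l == y).
Proof.
move=> part_l part_m; pose N := (size l + size m).+1.
rewrite (@sum_ups N) ?(@sum_downs N) /N; try lia.
rewrite big_mkcond [RHS]big_mkcond; apply: eq_bigr => i _ /=.
have ifE (a b : bool) : (if a then nat_of_bool b else 0) = a && b by case: a.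
by rewrite !ifE incr_nth_eq.
Qed.

Lemma dotp_up L L' : all is_intpart L -> all is_intpart L' ->
  dotp (up L) L' = dotp L (down L').
Proof.
move=> part_L part_L'; rewrite /dotp big_flatten big_map.
apply: eq_big_seq => l /(allP part_L) part_l.
rewrite big_flatten big_map exchange_big; apply: eq_big_seq => m /(allP part_L').
exact: sum_ups_downs.
Qed.

Lemma dotpC L L' : dotp L L' = dotp L' L.
Proof.
rewrite /dotp exchange_big; apply: eq_bigr => x _.
by apply: eq_bigr => y _; rewrite eq_sym.
Qed.

Lemma dotp_down_up L L' : all is_intpart L' ->
  dotp L (down (up L')) = dotp L L' + dotp L (up (down L')).
Proof.
move=> part_L'; rewrite /dotp -big_split; apply: eq_bigr => x _ /=.
rewrite !big_flatten !big_map !big_flatten !big_map -big_split.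
apply: eq_big_seq => l /(allP part_L') part_l /=.
exact: sum_downs_ups.
Qed.

(** D U^b = U^b D + b U^(b-1), in weak form: pairing with an arbitrary L avoids
    substituting equal formal sums under U, since by adjointness a U on the
    right can be moved to a D on the left. *)
Lemma dotp_down_iter_up b L L' : all is_intpart L -> all is_intpart L' ->
  dotp L (down (iter b up L')) =
  dotp L (iter b up (down L')) + b * dotp L (iter b.-1 up L').
Proof.
elim: b L => [|b IHb] L part_L part_L'; first by rewrite mul0n addn0.
have part_b c L0 : all is_intpart L0 -> all is_intpart (iter c up L0).
  by move=> part_L0; elim: c => //= c; apply: up_intpart.
rewrite iterS dotp_down_up; last exact: part_b.
rewrite dotpC [X in _ + X]dotpC dotp_up //; try by apply/down_intpart/part_b.
rewrite [X in _ + X]dotpC IHb //; last exact: down_intpart.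
rewrite ![dotp (down L) _]dotpC -!dotp_up ?part_b ?down_intpart //.
rewrite -!iterS [dotp _ L]dotpC [X in _ + (X + _)]dotpC.
case: b IHb => [|b] _; rewrite ?mul0n ?mul1n /=; last by rewrite [X in _ * X]dotpC; lia.
by rewrite addn0 addnC.
Qed.

(** The one-row partition of m, which is the empty one when m = 0. *)
Definition row_shape m := nseq (0 < m) m.

Lemma row_shape_intpart m : is_intpart (row_shape m).
Proof. by case: m. Qed.

Lemma down_row_shape m : down [:: row_shape m.+1] = [:: row_shape m].
Proof. by case: m => [|m]; rewrite /row_shape /down /downs /decr_nth. Qed.

(** The number of partial injections from a set with a elements to one with b
    elements: one given element of the source is either left out or sent to one
    of the b elements of the target. *)
Fixpoint npinj a b :=
  if a is a'.+1 then npinj a' b + b * npinj a' b.-1 else 1.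

(** One U on the left is moved across as a D on the right.  The term U^b D
    turns (n - b) into (n - 1 - b), the b terms U^(b-1) keep
    n - b = (n - 1) - (b - 1): both are instances for n - 1.  The bound a + b <= n
    keeps n - b positive as long as a is, so that D (n - b) does not vanish. *)
Lemma dotp_rows a b n : a + b <= n ->
  dotp (iter a up [:: row_shape (n - a)]) (iter b up [:: row_shape (n - b)]) =
  npinj a b.
Proof.
have part_b c m : all is_intpart (iter c up [:: row_shape m]).
  by elim: c => [|c]; rewrite /= ?row_shape_intpart //; apply: up_intpart.
elim: a b n => [|a IHa] b n.
  rewrite add0n; elim: b n => [|b IHb] n.
    by rewrite !subn0 /dotp /= !big_seq1 eqxx.
  case: n => // n lt_bn; rewrite /= dotpC dotp_up ?part_b ?(part_b 0) //.
  by rewrite subn0 subSS down_row_shape dotpC -[n in row_shape n]subn0 IHb.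
case: n => // n le_ab; rewrite subSS iterS dotp_up // subSn; last by lia.
rewrite dotp_down_iter_up ?part_b ?(part_b 0) //.
rewrite down_row_shape IHa; last by lia.
case: b le_ab => [|b] le_ab //=; rewrite -subSS -subSn ?IHa //; lia.
Qed.

(** * Set partitions of a disjoint union *)

Section Merge.
Variable T : finType.
Implicit Types (A B D X Y Z : {set T}) (P Q : {set {set T}}).

(** A block of Q meets some block of P, and this is itself a block of Q. *)
Lemma partition_sub_eq P Q D :
  partition P D -> partition Q D -> P \subset Q -> P = Q.
Proof.
move=> /and3P[/eqP covP _ _] /and3P[/eqP covQ trQ nQ0] sPQ.
apply/eqP; rewrite eqEsubset sPQ; apply/subsetP => Y QY.
have /set0Pn[y Yy] : Y != set0 by apply: contraNneq nQ0 => <-.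
have: y \in cover P by rewrite covP -covQ; apply/bigcupP; exists Y.
case/bigcupP => Z PZ Zy; rewrite -(def_pblock trQ QY Yy).
by rewrite (def_pblock trQ (subsetP sPQ _ PZ) Zy).
Qed.

(** The set partitions of A :|: B that restrict to P on A and to Q on B (see
    [mergesE]).  The condition is stated block by block, set0 being allowed as
    a trace, because in this form it survives the removal of one block. *)
Definition merges A B P Q := [set R : {set {set T}} |
  partition R (A :|: B) &
  [forall Z in R, (Z :&: A \in set0 |: P) && (Z :&: B \in set0 |: Q)]].

Lemma mergesP A B P Q R : reflect
  (partition R (A :|: B) /\ forall Z, Z \in R ->
     Z :&: A \in set0 |: P /\ Z :&: B \in set0 |: Q)
  (R \in merges A B P Q).
Proof.
rewrite inE; apply: (iffP andP) => -[part_R blk]; split=> //.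
  by move=> Z RZ; move/forall_inP: blk => /(_ _ RZ)/andP.
by apply/forall_inP => Z /blk[-> ->].
Qed.

Lemma setI_setD_disjoint Z X A : [disjoint Z & X] -> Z :&: (A :\: X) = Z :&: A.
Proof.
by move=> dZX; rewrite setIDA; apply/setDidPl; apply: disjointWl dZX; apply: subsetIl.
Qed.

Lemma block_disjoint P D X Z : partition P D -> X \in P -> Z \in P -> Z != X ->
  [disjoint Z & X].
Proof. by case/and3P => _ /trivIsetP trP _ PX PZ; apply: trP. Qed.

Lemma block_subset P D X : partition P D -> X \in P -> X \subset D.
Proof. by case/and3P => /eqP <- _ _ PX; apply: bigcup_sup. Qed.

(** If the block of R containing X is X :|: Y, what remains of R is a merge of
    what remains of P and Q; Y = set0 is the case where X is left alone. *)
Lemma merges_block A B P Q X Y : partition P A -> partition Q B ->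
  [disjoint A & B] -> X \in P -> Y \in set0 |: Q ->
  [set R in merges A B P Q | X :|: Y \in R] =
  [set (X :|: Y) |: R | R in merges (A :\: X) (B :\: Y) (P :\ X) (Q :\ Y)].
Proof.
move=> part_P part_Q dAB PX QY; have sXA := block_subset part_P PX.
have sYB : Y \subset B.
  by move: QY; rewrite !inE => /predU1P[->|/(block_subset part_Q)//]; apply: sub0set.
have nX0 : X != set0 by case/and3P: part_P => _ _; apply: contraNneq => <-.
have XYA : (X :|: Y) :&: A = X.
  rewrite setIUl (setIidPl sXA); apply/setUidPl.
  rewrite (_ : Y :&: A = set0) ?sub0set //; apply/disjoint_setI0.
  by rewrite disjoint_sym; apply: disjointWr dAB.
have XYB : (X :|: Y) :&: B = Y.
  rewrite setIUl (setIidPl sYB); apply/setUidPr.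
  rewrite (_ : X :&: B = set0) ?sub0set //; apply/disjoint_setI0.
  exact: disjointWl dAB.
have AB_XY : (A :|: B) :\: (X :|: Y) = (A :\: X) :|: (B :\: Y).
  apply/setP => x; rewrite !inE negb_or.
  have := subsetP sXA x; have := subsetP sYB x.
  have : ~~ ((x \in A) && (x \in B)).
    by move/disjoint_setI0/setP/(_ x): dAB; rewrite !inE => ->.
  by do ![case: (x \in _)] => //; auto.
apply/setP => R; apply/idP/imsetP => [|[R' /mergesP[part_R' blk] ->]].
  rewrite inE => /andP[/mergesP[part_R blk] RXY]; exists (R :\ (X :|: Y)).
    apply/mergesP; split; first by rewrite -AB_XY; apply: partitionD1.
    move=> Z /setD1P[neZ RZ]; have [ZA ZB] := blk Z RZ.
    have dZ := block_disjoint part_R RXY RZ neZ.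
    have dZX : [disjoint Z & X] by apply: disjointWr dZ; apply: subsetUl.
    have dZY : [disjoint Z & Y] by apply: disjointWr dZ; apply: subsetUr.
    rewrite !setI_setD_disjoint //; split.
      move: ZA; rewrite !inE => /predU1P[->|PZA]; rewrite ?eqxx //.
      rewrite PZA andbT orbC; case: eqVneq => //= ZAX.
      case/set0Pn: nX0 => x Xx; have := Xx; rewrite -ZAX inE => /andP[Zx _].
      by have := disjointFr dZX Zx; rewrite Xx.
    move: ZB; rewrite !inE => /predU1P[->|PZB]; rewrite ?eqxx //.
    rewrite PZB andbT orbC; case: eqVneq => //= ZBY.
    rewrite -(setIid (Z :&: B)) {1}ZBY setIA (disjoint_setI0 (A := Y)) ?set0I //.
    by rewrite disjoint_sym.
  by rewrite setD1K.
have dXY : [disjoint X :|: Y & A :\: X :|: B :\: Y].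
  by rewrite -AB_XY disjoint_sym -setI_eq0 setIDAC setDIl setDv setI0.
have nXY0 : X :|: Y != set0 by rewrite setU_eq0 negb_and nX0.
have eqU : (X :|: Y) :|: (A :\: X :|: B :\: Y) = A :|: B.
  by rewrite -[RHS](setID _ (X :|: Y)) (setIidPr (setUSS sXA sYB)) AB_XY.
rewrite inE setU11 andbT; apply/mergesP; split.
  by rewrite -eqU; apply: partitionU1.
move=> Z /setU1P[->|R'Z]; first by rewrite XYA XYB QY in_setU1 PX orbT.
have [ZA ZB] := blk Z R'Z; have sZ := block_subset part_R' R'Z.
have dZ: [disjoint Z & X :|: Y].
  by rewrite disjoint_sym; apply: disjointWr dXY.
have dZX : [disjoint Z & X] by apply: disjointWr dZ; apply: subsetUl.
have dZY : [disjoint Z & Y] by apply: disjointWr dZ; apply: subsetUr.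
rewrite !setI_setD_disjoint // in ZA ZB.
by split; [move: ZA | move: ZB]; apply/subsetP/setUS/subsetDl.
Qed.

Lemma card_merges_block A B P Q X Y : partition P A -> partition Q B ->
  [disjoint A & B] -> X \in P -> Y \in set0 |: Q ->
  #|[set R in merges A B P Q | X :|: Y \in R]| =
  #|merges (A :\: X) (B :\: Y) (P :\ X) (Q :\ Y)|.
Proof.
move=> part_P part_Q dAB PX QY; rewrite merges_block // card_in_imset //.
have nX0 : X != set0 by case/and3P: part_P => _ _; apply: contraNneq => <-.
have notin R : R \in merges (A :\: X) (B :\: Y) (P :\ X) (Q :\ Y) ->
    X :|: Y \notin R.
  case/mergesP => part_R _; apply/negP => /(block_subset part_R).
  case/set0Pn: nX0 => x Xx /subsetP/(_ x); rewrite !inE Xx /= => /(_ isT).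
  by rewrite (disjointFr dAB (subsetP (block_subset part_P PX) x Xx)) andbF.
by move=> R R' /notin nR /notin nR' eqR; rewrite -(setU1K nR) eqR setU1K.
Qed.

(** The block of R through a point x of X has trace X on A, so it is X :|: Y for
    its trace Y on B.  The boolean form lets R be classified by Y. *)
Lemma merges_meet A B P Q X x R : partition P A -> partition Q B ->
  [disjoint A & B] -> X \in P -> x \in X -> R \in merges A B P Q ->
  (pblock R x :&: B \in set0 |: Q) &&
  [forall Y in set0 |: Q, (pblock R x :&: B == Y) == (X :|: Y \in R)].
Proof.
move=> part_P part_Q dAB PX Xx /mergesP[part_R blk].
have Ax := subsetP (block_subset part_P PX) x Xx.
case/and3P: part_R => /eqP covR trR nR0.
case/and3P: part_P => /eqP covP trP nP0.
have covRx : x \in cover R by rewrite covR inE Ax.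
set Z := pblock R x; have RZ : Z \in R by apply: pblock_mem.
have Zx : x \in Z by rewrite mem_pblock.
have [ZA ZB] := blk Z RZ; rewrite ZB /=.
have {}ZA : Z :&: A = X.
  case/setU1P: ZA => [/setP/(_ x)|PZ]; first by rewrite !inE Zx Ax.
  rewrite -(def_pblock trP PX Xx); symmetry.
  by apply: def_pblock => //; rewrite inE Zx.
have sZ : Z \subset A :|: B by rewrite -covR; apply: (bigcup_sup Z).
have defZ : Z = X :|: (Z :&: B) by rewrite -ZA -setIUr; symmetry; apply/setIidPl.
apply/forall_inP => Y QY; apply/eqP; apply/eqP/idP => [<-|RXY].
  by rewrite -defZ.
have eqZ : Z = X :|: Y by apply: def_pblock => //; rewrite inE Xx.
rewrite eqZ setIUl (_ : X :&: B = set0) ?set0U; last first.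
  apply/disjoint_setI0; apply: disjointWl dAB.
  by rewrite -covP; apply: (bigcup_sup X).
apply/setIidPl; case/setU1P: QY => [->|]; first exact: sub0set.
exact: block_subset.
Qed.

(** The choice of the partner Y of one block X of P (none, or a block of Q)
    reproduces the recursion of [npinj]. *)
Lemma card_merges A B P Q : partition P A -> partition Q B ->
  [disjoint A & B] -> #|merges A B P Q| = npinj #|P| #|Q|.
Proof.
elim: {P}_.+1 {-2}P (ltnSn #|P|) A B Q => // a IHa P le_Pa A B Q part_P part_Q dAB.
have nQ0 : set0 \notin Q by case/and3P: part_Q.
case: (set_0Vmem P) => [P0|[X PX]].
  rewrite P0 cards0 /=.
  have A0 : A = set0 by case/and3P: part_P => /eqP <- _ _; rewrite P0 /cover big_set0.
  rewrite -(cards1 Q); congr #|pred_of_set _|; apply/setP => R.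
  rewrite in_set1; apply/mergesP/eqP; rewrite A0 set0U.
    case=> part_R blk; apply: (partition_sub_eq part_R part_Q).
    apply/subsetP => Z RZ; have [_] := blk Z RZ.
    rewrite (setIidPl (block_subset part_R RZ)) => /setU1P[Z0|//].
    by case/and3P: part_R => _ _; rewrite -Z0 RZ.
  move=> ->; split=> // Z QZ.
  by rewrite setI0 (setIidPl (block_subset part_Q QZ)) !inE QZ eqxx orbT.
have nX0 : X != set0 by case/and3P: part_P => _ _; apply: contraNneq => <-.
have [x Xx] := set0Pn _ nX0.
have cardP : #|P| = #|P :\ X|.+1 by rewrite (cardsD1 X) PX.
have cardY Y : Y \in set0 |: Q ->
    #|[set R in merges A B P Q | pblock R x :&: B == Y]| =
    npinj #|P :\ X| #|Q :\ Y|.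
  move=> QY; rewrite -(IHa _ _ (A :\: X) (B :\: Y)); first last.
  - by apply: disjointW dAB; apply: subsetDl.
  - case/setU1P: QY => [->|]; last exact: partitionD1.
    by rewrite setD0 (setDidPl _) // disjoint_sym disjoints1.
  - exact: partitionD1.
  - by rewrite -ltnS -cardP.
  rewrite -card_merges_block //; apply: eq_card => R; rewrite !inE.
  have [mR|] /= := boolP (R \in merges A B P Q); last by rewrite inE => /negbTE->.
  move: (mR); rewrite inE => ->.
  have /andP[_ /forall_inP/(_ Y QY)/eqP] := merges_meet part_P part_Q dAB PX Xx mR.
  by [].
rewrite -sum1_card (partition_big (fun R => pblock R x :&: B)
  (fun Y => Y \in set0 |: Q)) /=; last first.
  by move=> R /(merges_meet part_P part_Q dAB PX Xx)/andP[].
rewrite (eq_bigr (fun Y => npinj #|P :\ X| #|Q :\ Y|)) => [|Y QY]; last first.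
  by rewrite -cardY // -sum1_card; apply: eq_bigl => R; rewrite inE.
rewrite big_setU1 //= cardP /= (_ : Q :\ set0 = Q); last first.
  by apply/setDidPl; rewrite disjoint_sym disjoints1.
congr (_ + _); rewrite -sum_nat_const; apply: eq_bigr => Y QY.
by rewrite (cardsD1 Y Q) QY.
Qed.

Definition restr A P := [set Z :&: A | Z in P] :\ set0.

Lemma restr_partition P D A : A \subset D -> partition P D ->
  partition (restr A P) A.
Proof.
move=> sAD /and3P[/eqP covP trP nP0]; apply/and3P; split.
- rewrite eqEsubset; apply/andP; split.
    apply/bigcupsP => _ /setD1P[_ /imsetP[Z _ ->]]; exact: subsetIr.
  apply/subsetP => x Ax; have : x \in cover P by rewrite covP (subsetP sAD).
  case/bigcupP => Z PZ Zx; apply/bigcupP; exists (Z :&: A); rewrite ?inE ?Zx //.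
  apply/andP; split; last exact: imset_f.
  by apply/set0Pn; exists x; rewrite inE Zx.
- apply/trivIsetP => _ _ /setD1P[_ /imsetP[Z PZ ->]] /setD1P[_ /imsetP[Y PY ->]].
  move=> neZY; apply: (@disjointW _ _ Z _ Y); rewrite ?subsetIl //.
  by apply: (trivIsetP trP) => //; apply: contraNneq neZY => ->.
by rewrite !inE eqxx.
Qed.

Lemma mergesE A B P Q R : partition P A -> partition Q B ->
  R \in merges A B P Q =
  [&& partition R (A :|: B), restr A R == P & restr B R == Q].
Proof.
move=> part_P part_Q; apply/mergesP/and3P => [[part_R blk]|].
  have part_RA := restr_partition (subsetUl A B) part_R.
  have part_RB := restr_partition (subsetUr A B) part_R.
  split=> //; apply/eqP.
    apply: (partition_sub_eq part_RA part_P).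
    apply/subsetP => W /setD1P[n0 /imsetP[Z /blk[ZA _] eqZ]].
    by move: ZA; rewrite -eqZ !inE (negbTE n0).
  apply: (partition_sub_eq part_RB part_Q).
  apply/subsetP => W /setD1P[n0 /imsetP[Z /blk[_ ZB] eqZ]].
  by move: ZB; rewrite -eqZ !inE (negbTE n0).
case=> part_R /eqP defP /eqP defQ; split=> // Z RZ.
have mem_restr C : Z :&: C \in set0 |: restr C R.
  by rewrite in_setU1 in_setD1 (imset_f (fun Z => Z :&: C) RZ) andbT orbN.
by rewrite -defP -defQ.
Qed.

(** The set partitions of A :|: B are classified by their restrictions. *)
Lemma card_partitions_disjointU A B : [disjoint A & B] ->
  #|[set R : {set {set T}} | partition R (A :|: B)]| =
  \sum_(P : {set {set T}} | partition P A)
    \sum_(Q : {set {set T}} | partition Q B) npinj #|P| #|Q|.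
Proof.
move=> dAB; rewrite -sum1_card (partition_big (restr A)
  (fun P => partition P A)) /=; last first.
  by move=> R; rewrite inE; apply/restr_partition/subsetUl.
apply: eq_bigr => P part_P; rewrite (partition_big (restr B)
  (fun Q => partition Q B)) /=; last first.
  by move=> R; rewrite inE => /andP[+ _]; apply/restr_partition/subsetUr.
apply: eq_bigr => Q part_Q; rewrite -(card_merges part_P part_Q dAB) -sum1_card.
by apply: eq_bigl => R; rewrite mergesE // inE andbA.
Qed.

End Merge.

(** * Tableaux with given blocks *)

Section Tableaux.
Variable k : nat.
Implicit Types (T : filling k) (r s : seq {set letter k}) (X Y : {set letter k}).

Lemma last_lt_trans : transitive (@last_lt k).
Proof.
move=> Y X Z /andP[nY0 ltXY] /andP[nZ0 ltYZ]; rewrite /last_lt nZ0 /=.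
move: ltYZ; rewrite (negbTE nY0) /= => ltYZ.
by case/orP: ltXY => [->//|ltXY]; rewrite (ltn_trans ltXY) ?orbT.
Qed.

Lemma last_lt_irr : irreflexive (@last_lt k).
Proof. by move=> X; rewrite /last_lt ltnn orbF andNb. Qed.

Lemma last_le_trans : transitive (@last_le k).
Proof.
move=> Y X Z /predU1P[->|ltXY] //; rewrite /last_le => /predU1P[<-|ltYZ].
  by rewrite ltXY orbT.
by rewrite (last_lt_trans ltXY) ?orbT.
Qed.

Lemma last_lt_set0 X : last_lt set0 X = (X != set0).
Proof. by rewrite /last_lt eqxx andbT. Qed.

Definition row T i := nth [::] T i.

Lemma nth_shape T i : nth 0 (shape T) i = size (row T i).
Proof.
have [lt_i|ge_i] := ltnP i (size T); first by rewrite (nth_map [::]).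
by rewrite /row !nth_default ?size_map.
Qed.

(** The part of the definition of a standard multiset tableau that does not
    refer to its content. *)
Definition is_tab T :=
  [&& is_intpart (shape T), all (sorted (@last_le k)) T & sorted (@column_lt k) T].

Lemma column_lt_nil r : column_lt r [::].
Proof. by case: r. Qed.

(** Reading rows beyond the last one as empty makes all conditions uniform in
    the row index. *)
Lemma is_tabP T : reflect
  [/\ forall i, i < size T -> 0 < size (row T i),
      forall i, size (row T i.+1) <= size (row T i),
      forall i, sorted (@last_le k) (row T i)
    & forall i, column_lt (row T i) (row T i.+1)] (is_tab T).
Proof.
apply: (iffP and3P) => [[/intpartP[leT posT] sortT colT]|[posT leT sortT colT]].
  split=> i; first by move=> lt_i; rewrite -nth_shape posT ?size_map.
  - by rewrite -!nth_shape.
  - have [lt_i|ge_i] := ltnP i (size T); last by rewrite /row nth_default.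
    exact: (all_nthP _ sortT).
  have [lt_i|ge_i] := ltnP i.+1 (size T).
    exact: (sortedP [::] colT).
  by rewrite [row T i.+1]nth_default // column_lt_nil.
split; last by apply/(sortedP [::]) => i _; apply: colT.
  apply/intpartP; split=> i; first by rewrite !nth_shape.
  by rewrite size_map nth_shape; apply: posT.
by apply/(all_nthP [::]) => i _; apply: sortT.
Qed.

Lemma is_tab_ext T T' : is_tab T -> is_tab T' -> row T =1 row T' -> T = T'.
Proof.
move=> /is_tabP[posT _ _ _] /is_tabP[posT' _ _ _] eq_row.
apply: (eq_from_nth (x0 := [::])) => [|i _]; last exact: eq_row.
apply/eqP; rewrite eqn_leq; apply/andP; split; rewrite leqNgt; apply/negP.
  by move=> /posT; rewrite eq_row /row nth_default.
by move=> /posT'; rewrite -eq_row /row nth_default.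
Qed.

Definition add_cell T i X := set_nth [::] T i (rcons (row T i) X).

Lemma row_add_cell T i X j :
  row (add_cell T i X) j = if j == i then rcons (row T i) X else row T j.
Proof. by rewrite /row /add_cell nth_set_nth. Qed.

Lemma shape_add_cell T i X : i <= size T ->
  shape (add_cell T i X) = incr_nth (shape T) i.
Proof.
move=> le_i; apply: (eq_from_nth (x0 := 0)) => [|j _].
  by rewrite size_map size_set_nth size_incr_nth size_map; case: ltnP; lia.
rewrite nth_incr_nth !nth_shape row_add_cell eq_sym.
by case: eqP => [->|//]; rewrite size_rcons.
Qed.

Lemma flatten_add_cell T i X : i <= size T ->
  perm_eq (flatten (add_cell T i X)) (X :: flatten T).
Proof.
rewrite /add_cell; elim: T i => [|r T IHT] [|i] //= le_i.
  by rewrite -cats1 -catA /= perm_catC /= perm_cons perm_catC.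
apply: perm_trans (_ : perm_eq _ (r ++ X :: flatten T)) _.
  by rewrite perm_cat2l; apply: IHT.
by rewrite -(cat1s X) perm_catCA.
Qed.

(** The new cell of the lower row is compared only with an entry of r1, and
    all of these are below X. *)
Lemma column_lt_rconsr r1 r2 X : size r2 < size r1 -> all (@last_lt k ^~ X) r1 ->
  column_lt r1 (rcons r2 X) = column_lt r1 r2.
Proof.
rewrite /column_lt; elim: r1 r2 => [|Y r1 IH] [|Z r2] //= lt_r /andP[ltY lt_r1].
  by rewrite ltY; case: (r1).
by rewrite IH.
Qed.

(** The new cell of the upper row has nothing below it. *)
Lemma column_lt_rconsl r1 r2 X : size r2 <= size r1 ->
  column_lt (rcons r1 X) r2 = column_lt r1 r2.
Proof.
rewrite /column_lt; elim: r1 r2 => [|Y r1 IH] [|Z r2] //= lt_r.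
by rewrite IH.
Qed.

Lemma column_lt_rcons r1 r2 X : column_lt r1 (rcons r2 X) -> column_lt r1 r2.
Proof.
rewrite /column_lt; elim: r1 r2 => [|Y r1 IH] [|Z r2] //= /andP[-> /=].
exact: IH.
Qed.

Lemma sorted_rcons_max r X : sorted (@last_le k) r -> all (@last_lt k ^~ X) r ->
  sorted (@last_le k) (rcons r X).
Proof.
case: r => //= Y r sort_r /andP[ltY lt_r]; rewrite rcons_path sort_r /=.
rewrite /last_le; apply/orP; right.
have := mem_last Y r; rewrite inE => /predU1P[->//|]; exact: (allP lt_r).
Qed.

Lemma all_row (a : pred {set letter k}) T i : all a (flatten T) -> all a (row T i).
Proof.
have [lt_i|ge_i] := ltnP i (size T); last by rewrite /row nth_default.
move=> /allP aT; apply/allP => X Xi; apply: aT; apply/flattenP.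
by exists (row T i); rewrite ?mem_nth.
Qed.

Lemma is_tab_add_cell T i X : is_tab T -> all (@last_lt k ^~ X) (flatten T) ->
  addable (shape T) i -> is_tab (add_cell T i X).
Proof.
move=> /is_tabP[posT leT sortT colT] maxX add_i.
have le_i := addable_size add_i; rewrite size_map in le_i.
apply/is_tabP; split=> j; rewrite !row_add_cell.
- rewrite size_set_nth => lt_j; case: eqP => [_|ne_ji]; first by rewrite size_rcons.
  by apply: posT; lia.
- have := leT j; case: (j.+1 =P i) => [defi|_]; case: (j =P i) => [eq_ji|_] //.
  + by move: add_i; rewrite -defi /addable /= !nth_shape size_rcons.
  by rewrite eq_ji size_rcons; lia.
- by case: eqP => [_|//]; apply: sorted_rcons_max => //; apply: all_row.
case: (j.+1 =P i) => [defi|_]; case: (j =P i) => [eq_ji|_] //.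
- by lia.
- rewrite -defi column_lt_rconsr ?all_row //.
  by move: add_i; rewrite /addable -defi /= !nth_shape.
by rewrite -eq_ji column_lt_rconsl.
Qed.

(** Entries weakly increase along a row, so a maximal one can only be repeated
    up to the end. *)
Lemma sorted_max_rcons r X : sorted (@last_le k) r -> X \in r ->
  (forall Y, Y \in r -> ~~ last_lt X Y) -> exists r', r = rcons r' X.
Proof.
case/lastP: r => // r Z sort_r; rewrite mem_rcons inE => /predU1P[->|Xr] maxX.
  by exists r.
exists r; congr rcons; apply/eqP; rewrite eq_sym.
have: last_le X Z.
  have: pairwise (@last_le k) (rcons r Z).
    by rewrite -(sorted_pairwise last_le_trans).
  by rewrite -cats1 pairwise_cat allrel1r => /andP[/allP/(_ X Xr)].
by rewrite /last_le (negbTE (maxX Z _)) ?orbF // mem_rcons mem_head.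
Qed.

(** The largest entry sits at the end of its row, and the next row is shorter:
    the entry below it would have to be larger.  So it occupies a corner, and
    removing it leaves a tableau. *)
Lemma is_tab_remove_max T s X : is_tab T -> perm_eq (flatten T) (X :: s) ->
  all (@last_lt k ^~ X) s ->
  exists T' i, [/\ is_tab T', addable (shape T') i & T = add_cell T' i X].
Proof.
move=> tabT permT maxX; have [posT leT sortT colT] := is_tabP _ tabT.
have notlt Y : Y \in flatten T -> ~~ last_lt X Y.
  rewrite (perm_mem permT) inE => /predU1P[->|sY]; first by rewrite last_lt_irr.
  apply: contraFN (last_lt_irr X) => ltXY; apply: last_lt_trans ltXY _.
  exact: (allP maxX).
have mem_row i Y : Y \in row T i -> Y \in flatten T.
  by move: Y; apply/allP; apply: all_row; apply/allP.
have /flattenP[_ /(nthP [::])[i lt_i <-] Xi] : X \in flatten T.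
  by rewrite (perm_mem permT) mem_head.
have [r def_r] : exists r, row T i = rcons r X.
  by apply: sorted_max_rcons => // Y /mem_row/notlt.
have le_r : size (row T i.+1) <= size r.
  have:= leT i; rewrite def_r size_rcons leq_eqVlt => /predU1P[sz|//].
  have /(all_nthP (set0, set0))/(_ (size r)) := colT i.
  rewrite size_zip def_r size_rcons sz minnn ltnSn => /(_ isT).
  rewrite nth_zip ?size_rcons //= nth_rcons ltnn eqxx => ltX.
  have /mem_row/notlt/negP[] // : nth set0 (row T i.+1) (size r) \in row T i.+1.
  by rewrite mem_nth ?sz.
have sizeT : r = [::] -> size T = i.+1.
  move=> r0; apply/eqP; rewrite eqn_leq lt_i andbT leqNgt; apply/negP => /posT.
  by move: le_r; rewrite r0 leqn0 => /eqP->.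
pose T' := if r == [::] then take i T else set_nth [::] T i r.
have rowT' j : row T' j = if j == i then r else row T j.
  rewrite /T'; case: eqP => [r0|_]; last by rewrite /row nth_set_nth.
  rewrite /row; case: (ltngtP j i) => [lt_ji|lt_ij|->].
  - by rewrite nth_take.
  - rewrite !nth_default ?size_take ?lt_i ?sizeT // ltnW //.
  by rewrite r0 nth_default // size_take lt_i.
have sizeT' : i <= size T' <= size T.
  rewrite /T'; case: ifP => _; first by rewrite size_take lt_i leqnn ltnW.
  by rewrite size_set_nth (maxn_idPr lt_i) ltnW //=.
have posT' j : j < size T' -> 0 < size (row T' j).
  rewrite rowT'; case: eqP => [-> | _ lt_j]; last by apply: posT; lia.
  rewrite /T'; case: (r) => //=; by rewrite size_take lt_i ltnn.
have tabT' : is_tab T'.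
  apply/is_tabP; split=> // j; rewrite !rowT'.
  - have := leT j; case: (j.+1 =P i) => [defi|_]; case: (j =P i) => [eq_ji|_] //.
    + by rewrite defi def_r size_rcons; apply: leq_trans.
    by rewrite eq_ji => _.
  - case: eqP => [_|_] //; have := sortT i; rewrite def_r -cats1.
    by case/cat_sorted2.
  have := colT j; case: (j.+1 =P i) => [defi|_]; case: (j =P i) => [eq_ji|_] //.
  - by lia.
  - by rewrite defi def_r; apply: column_lt_rcons.
  by rewrite eq_ji def_r column_lt_rconsl.
exists T', i; split=> //.
  rewrite /addable !nth_shape !rowT' eqxx.
  case: i leT def_r {lt_i Xi le_r sizeT T' rowT' sizeT' posT' tabT'} => //= i leT def_r.
  by rewrite ltn_eqF //=; have := leT i; rewrite def_r size_rcons.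
apply: (eq_from_nth (x0 := [::])) => [|j _]; last first.
  by rewrite -!/(row _ _) row_add_cell !rowT' eqxx; case: eqP => [->|].
rewrite size_set_nth /T'; case: eqP => [r0|_].
  by rewrite sizeT // size_take lt_i maxnC; lia.
by rewrite size_set_nth !(maxn_idPr lt_i).
Qed.

(** All tableaux made of m empty sets and the entries of s, where s lists the
    blocks from the largest to the smallest, so that the recursion adds the
    largest block last. *)
Fixpoint tabs m s :=
  if s is X :: s' then
    [seq add_cell T i X | T <- tabs m s',
                          i <- [seq i <- iota 0 (size T).+1 | addable (shape T) i]]
  else [:: [:: nseq m set0]].

(** Whether a block can be added in a given row depends only on the shape. *)
Lemma shape_tabs m s : 0 < m ->
  map shape (tabs m s) = iter (size s) up [:: row_shape m].
Proof.
case: m => // m _; elim: s => [|X s /= <-]; first by rewrite /= /shape /= size_nseq.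
rewrite /up map_flatten -!map_comp; congr flatten; apply: eq_map => T.
pose I := [seq i <- iota 0 (size T).+1 | addable (shape T) i].
rewrite -[LHS]/(map shape (map (add_cell T ^~ X) I)) -map_comp /comp /ups size_map.
apply/eq_in_map => i.
by rewrite mem_filter mem_iota => /and3P[_ _ lt_i]; apply: shape_add_cell.
Qed.

(** Together with set0, all entries of s are comparable in last letter order. *)
Definition decreasing s :=
  pairwise (fun X Y => last_lt Y X) s && (set0 \notin s).

Lemma decreasing_cons X s : decreasing (X :: s) =
  [&& all (@last_lt k ^~ X) s, X != set0 & decreasing s].
Proof.
by rewrite /decreasing /= inE negb_or (eq_sym set0) -!andbA; do !bool_congr.
Qed.

(** Empty sets cannot be stacked in a column, so they form a single row. *)
Lemma mem_tabs_nil m T : 0 < m ->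
  (T \in tabs m [::]) = is_tab T && perm_eq (flatten T) (nseq m set0).
Proof.
move=> m_gt0; rewrite inE; apply/eqP/andP => [->|[tabT permT]].
  split; last by rewrite /= cats0.
  case: m m_gt0 => // m _; rewrite /is_tab /is_intpart /= !andbT.
  by elim: m => //= m ->; rewrite /last_le eqxx.
have [posT leT _ colT] := is_tabP _ tabT.
have memT X : X \in flatten T -> X = set0.
  by rewrite (perm_mem permT) mem_nseq => /andP[_ /eqP].
case: T tabT permT posT leT colT memT => [|r [|r' T]].
- by move=> _ /perm_size /=; rewrite size_nseq => m0; rewrite -m0 in m_gt0.
- move=> _; rewrite /= cats0 => permT *; congr (_ :: _).
  by have /all_pred1P -> : all (pred1 set0) r;
    rewrite ?(perm_size permT) ?size_nseq // (perm_all _ permT) all_pred1_nseq.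
move=> _ _ posT _ /(_ 0) ltT memT; move: (posT 0 isT) (posT 1 isT) ltT.
rewrite /row /=; case: r {posT} memT => // X r; case: r' => // Y r' memT _ _.
by rewrite /column_lt /= (memT Y) /last_lt ?eqxx // !(inE, mem_cat) eqxx !orbT.
Qed.

Lemma mem_tabs m s T : 0 < m -> decreasing s ->
  (T \in tabs m s) = is_tab T && perm_eq (flatten T) (s ++ nseq m set0).
Proof.
move=> m_gt0; elim: s T => [|X s IHs] T; first by rewrite mem_tabs_nil.
rewrite decreasing_cons => /and3P[ltX nX0 dec_s].
have {}IHs T' := IHs T' dec_s.
have maxX : all (@last_lt k ^~ X) (s ++ nseq m set0).
  by rewrite all_cat ltX all_nseq /= last_lt_set0 nX0 orbT.
apply/allpairsPdep/andP => [[T' [i []]]|[tabT permT]].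
  rewrite IHs mem_filter => /andP[tabT' permT'] /andP[add_i _] ->.
  have le_i := addable_size add_i; rewrite size_map in le_i; split.
    by apply: is_tab_add_cell => //; rewrite (perm_all _ permT').
  by apply: perm_trans (flatten_add_cell _ le_i) _; rewrite perm_cons.
have [T' [i [tabT' add_i defT]]] := is_tab_remove_max tabT permT maxX.
have le_i := addable_size add_i; rewrite size_map in le_i.
exists T', i; rewrite IHs tabT' mem_filter add_i mem_iota; split=> //.
rewrite -(perm_cons X); apply: perm_trans permT.
by rewrite perm_sym defT; apply: flatten_add_cell.
Qed.

(** The cell of the new entry X is recognized as the only one labelled by X. *)
Lemma add_cell_inj T T' i i' X :
  is_tab T -> is_tab T' -> X \notin flatten T -> X \notin flatten T' ->
  add_cell T i X = add_cell T' i' X -> T = T' /\ i = i'.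
Proof.
move=> tabT tabT' nXT nXT' eqA.
have eq_row j : row (add_cell T i X) j = row (add_cell T' i' X) j by rewrite eqA.
have notin U j : X \notin flatten U -> X \notin row U j.
  move=> nXU; apply/negP => Xj; move: (all_row (a := predC1 X) (T := U) j).
  case/(_ _)/allP/(_ X Xj)/negP; rewrite //=.
  by apply/allP => Y UY; apply: contraNneq nXU => <-.
have eq_i : i = i'.
  apply/eqP; have := eq_row i; rewrite !row_add_cell eqxx; case: eqP => // _ eqX.
  by have := notin T' i nXT'; rewrite -eqX mem_rcons mem_head.
split=> //; apply: is_tab_ext => // j; have := eq_row j; rewrite !row_add_cell -eq_i.
by case: eqP => [->|//] /rcons_inj[].
Qed.

Lemma uniq_tabs m s : 0 < m -> decreasing s -> uniq (tabs m s).
Proof.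
move=> m_gt0; elim: s => // X s IHs; rewrite decreasing_cons => /and3P[ltX nX0 dec_s].
have nXT T : T \in tabs m s -> is_tab T /\ X \notin flatten T.
  rewrite mem_tabs // => /andP[tabT permT]; split=> //.
  rewrite (perm_mem permT) mem_cat mem_nseq (negbTE nX0) andbF orbF.
  by apply/negP => /(allP ltX); rewrite last_lt_irr.
apply: allpairs_uniq_dep; first exact: IHs.
  by move=> T _; rewrite filter_uniq ?iota_uniq.
move=> [T i] [T' i'] /allpairsPdep[T1 [i1 [T1s _ [-> _]]]].
move=> /allpairsPdep[T2 [i2 [T2s _ [-> _]]]] /= eqA.
have [tab1 nX1] := nXT _ T1s; have [tab2 nX2] := nXT _ T2s.
by have [-> ->] := add_cell_inj tab1 tab2 nX1 nX2 eqA.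
Qed.

End Tableaux.

(** * Tableaux with given content *)

Section Content.
Variables (k : nat) (C : {set letter k}).
Hypothesis posC : {in C &, injective (@letter_pos k)}.
Implicit Types (Q : {set {set letter k}}) (T : filling k).

Definition blocks Q : seq {set letter k} :=
  sort (fun X Y => max_pos Y <= max_pos X) (enum Q).

Lemma size_blocks Q : size (blocks Q) = #|Q|.
Proof. by rewrite size_sort -cardE. Qed.

Lemma max_posP (X : {set letter k}) :
  X != set0 -> exists2 a, a \in X & max_pos X = letter_pos a.
Proof.
case/set0Pn => a Xa; rewrite /max_pos.
have [|b Xb ->] := @eq_bigmax_cond _ (mem X) (@letter_pos k); last by exists b.
by apply/card_gt0P; exists a.
Qed.

(** Disjoint nonempty sets of letters of the same alphabet have different last
    letters, so last letter order is total on the blocks. *)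
Lemma decreasing_blocks Q : partition Q C -> decreasing (blocks Q).
Proof.
move=> /and3P[/eqP covQ trQ nQ0].
have mem_blocks X : (X \in blocks Q) = (X \in Q) by rewrite mem_sort mem_enum.
rewrite /decreasing mem_blocks nQ0 andbT.
have geq_trans : transitive (fun X Y : {set letter k} => max_pos Y <= max_pos X).
  by move=> Y X Z leYX leZY; apply: leq_trans leYX.
have geq_total : total (fun X Y : {set letter k} => max_pos Y <= max_pos X).
  by move=> X Y; apply: leq_total.
have : pairwise (fun X Y => (X != Y) && (max_pos Y <= max_pos X)) (blocks Q).
  rewrite -[_ _ _]/(pairwise [rel X Y | (X != Y) && (max_pos Y <= max_pos X)] _).
  rewrite pairwise_relI -uniq_pairwise sort_uniq enum_uniq /=.
  by rewrite -sorted_pairwise //; apply: sort_sorted.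
apply: (@sub_in_pairwise _ (mem Q)); last by apply/allP => X; rewrite mem_blocks.
move=> X Y QX QY /andP[neXY leYX].
have n0 Z : Z \in Q -> Z != set0 by move=> QZ; apply: contraNneq nQ0 => <-.
have sC Z : Z \in Q -> Z \subset C.
  by move=> QZ; rewrite -covQ; apply: (bigcup_sup Z).
rewrite /last_lt n0 //= ltn_neqAle leYX andbT (negbTE (n0 Y QY)) /=.
have [a Xa ->] := max_posP (n0 X QX); have [b Yb ->] := max_posP (n0 Y QY).
apply: contraNneq neXY => eq_ab.
have {}eq_ab : b = a.
  by apply: (posC _ _ eq_ab); [apply: (subsetP (sC Y QY)) | apply: (subsetP (sC X QX))].
by rewrite -(def_pblock trQ QX Xa) -(def_pblock trQ QY Yb) eq_ab.
Qed.

Lemma partition_card_le Q : partition Q C -> #|Q| <= #|C|.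
Proof.
move=> partQ; rewrite (card_partition partQ) -sum1_card; apply: leq_sum => X QX.
rewrite card_gt0; case/and3P: partQ => _ _ nQ0.
by apply: contraNneq nQ0 => <-.
Qed.

Definition has_content T :=
  all (fun X : {set letter k} => X \subset C) (flatten T) &&
  [forall a in C, count (fun X : {set letter k} => a \in X) (flatten T) == 1].

Lemma std_mset_tableauE T : std_mset_tableau C T = is_tab T && has_content T.
Proof.
rewrite /std_mset_tableau /is_tab /has_content -!andbA; do 2!congr (_ && _).
by rewrite andbA andbC -!andbA.
Qed.

(** A letter a of C lies in exactly one cell, the one labelled by the block of
    Q through a. *)
Lemma content_blocks Q s m : partition Q C ->
  perm_eq s (blocks Q ++ nseq m set0) ->
  all (fun X : {set letter k} => X \subset C) s &&
  [forall a in C, count (fun X : {set letter k} => a \in X) s == 1].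
Proof.
move=> /and3P[/eqP covQ trQ nQ0] perm_s; apply/andP; split.
  rewrite (perm_all _ perm_s) all_cat all_nseq sub0set orbT andbT.
  apply/allP => X; rewrite mem_sort mem_enum -covQ => QX; exact: (bigcup_sup X).
apply/forall_inP => a Ca; rewrite (permP perm_s) count_cat count_nseq inE mul0n addn0.
rewrite (permP (permEl (perm_sort _ _))) -sum1_count big_enum_cond /=.
rewrite (big_pred1 (pblock Q a)) // => X; apply/andP/eqP => [[QX Xa]|->].
  by rewrite (def_pblock trQ QX Xa).
by rewrite pblock_mem ?mem_pblock covQ.
Qed.

(** As each letter is used once, a nonempty entry cannot be repeated, and two
    different ones are disjoint: up to order, the entries are the blocks of a
    set partition and a number of empty sets. *)
Lemma content_partition s :
  all (fun X : {set letter k} => X \subset C) s ->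
  [forall a in C, count (fun X : {set letter k} => a \in X) s == 1] ->
  let Q := [set X in s | X != set0] in
  partition Q C /\ perm_eq s (blocks Q ++ nseq (size s - #|Q|) set0).
Proof.
move=> sC /forall_inP count1 Q.
have memQ X : (X \in Q) = (X \in s) && (X != set0) by rewrite !inE.
have count_le1 X : X \in Q -> count_mem X s = 1.
  rewrite memQ => /andP[sX /set0Pn[a Xa]].
  have Ca : a \in C by apply: (subsetP (allP sC X sX)).
  apply/eqP; rewrite eqn_leq -has_count has_pred1 sX andbT -(eqP (count1 a Ca)).
  by apply: sub_count => Y /eqP->.
have partQ : partition Q C.
  apply/and3P; split; last by rewrite memQ eqxx andbF.
    rewrite eqEsubset; apply/andP; split.
      by apply/bigcupsP => X; rewrite memQ => /andP[/(allP sC)].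
    apply/subsetP => a Ca; have := count1 a Ca.
    have [/hasP[X sX Xa] _|] := boolP (has (fun X : {set letter k} => a \in X) s).
      apply/bigcupP; exists X => //; rewrite memQ sX.
      by apply/set0Pn; exists a.
    by rewrite has_count -eqn0Ngt => /eqP->.
  apply/trivIsetP => X Y QX QY neXY; rewrite -setI_eq0; apply/set0Pn => -[a].
  rewrite inE => /andP[Xa Ya]; move: QX QY; rewrite !memQ => /andP[sX _] /andP[sY _].
  have Ca : a \in C by apply: (subsetP (allP sC X sX)).
  have := count1 a Ca; rewrite (permP (perm_to_rem sX)) /= Xa add1n eqSS => /eqP c0.
  have : Y \in rem X s.
    by move: sY; rewrite (perm_mem (perm_to_rem sX)) inE eq_sym (negbTE neXY).
  by move=> remY; have : has (fun X : {set letter k} => a \in X) (rem X s);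
    [apply/hasP; exists Y | rewrite has_count c0].
split=> //; apply/allP => X _ /=; rewrite count_cat count_nseq.
have -> : count_mem X (blocks Q) = (X \in Q).
  by rewrite count_uniq_mem ?sort_uniq ?enum_uniq // mem_sort mem_enum.
have [QX|] := boolP (X \in Q).
  rewrite count_le1 //= (_ : (set0 == X) = false) //.
  by rewrite eq_sym; apply/negbTE; move: QX; rewrite memQ => /andP[].
rewrite memQ negb_and negbK => nQX; have [->|nX0] := eqVneq X set0; last first.
  rewrite (negbTE nX0) orbF in nQX.
  by rewrite /= (eq_sym set0) (negbTE nX0) (count_memPn nQX).
rewrite /= eqxx mul1n add0n.
have -> : #|Q| = count (predC (pred1 set0)) s.
  rewrite -size_filter -(@card_uniqP _ (filter _ s) _).
    by apply: eq_card => Y; rewrite memQ mem_filter andbC.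
  apply: count_mem_uniq => Y; rewrite mem_filter andbC -memQ.
  have [QY|nQY] := boolP (Y \in Q); last first.
    by apply/count_memPn; rewrite mem_filter andbC -memQ.
  rewrite -[RHS](count_le1 Y QY) count_filter; apply: eq_count => Z /=.
  by case: eqP => [->|//]; move: QY; rewrite memQ => /andP[].
by rewrite -(count_predC (pred1 set0) s) addnK.
Qed.

(** The standard multiset tableaux of content C with n cells, classified by
    the set partition formed by their nonempty entries. *)
Definition all_tabs n : seq (filling k) :=
  [seq T | Q <- enum [set Q | partition Q C], T <- tabs (n - #|Q|) (blocks Q)].

(** As #|C| < n, each tableau has at least one empty cell, so the first row
    from which the blocks are added is never empty. *)
Lemma mem_all_tabs n T : #|C| < n ->
  (T \in all_tabs n) = (sumn (shape T) == n) && std_mset_tableau C T.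
Proof.
move=> lt_Cn; rewrite std_mset_tableauE.
apply/allpairsPdep/and3P => [[Q [T' [+ + ->]]]|[/eqP sumT tabT /andP[subC count1]]].
  rewrite mem_enum inE => partQ.
  have le_Q := partition_card_le partQ.
  rewrite mem_tabs ?decreasing_blocks //; last by rewrite subn_gt0; lia.
  case/andP => tabT permT; split=> //; last exact: content_blocks partQ permT.
  rewrite -size_flatten (perm_size permT) size_cat size_nseq size_blocks subnKC //.
  by lia.
have [partQ permT] := content_partition subC count1.
set Q := [set X in _ | _] in partQ permT.
have le_Q := partition_card_le partQ.
exists Q, T; rewrite mem_enum inE partQ; split=> //.
rewrite mem_tabs ?decreasing_blocks ?tabT //; last by rewrite subn_gt0; lia.
by rewrite -sumT -size_flatten.
Qed.

Lemma uniq_all_tabs n : #|C| < n -> uniq (all_tabs n).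
Proof.
move=> lt_Cn; have gt0 Q : partition Q C -> 0 < n - #|Q|.
  by move/partition_card_le; rewrite subn_gt0; lia.
apply: allpairs_uniq_dep; first exact: enum_uniq.
  move=> Q; rewrite mem_enum inE => partQ.
  by apply: uniq_tabs; rewrite ?gt0 ?decreasing_blocks.
move=> [Q T] [Q' T'] /allpairsPdep[Q1 [T1 [+ + [-> ->]]]].
move=> + + /allpairsPdep[Q2 [T2 [+ + [-> ->]]]] /= eqT.
rewrite !mem_enum !inE eqT => partQ1 + partQ2.
rewrite !mem_tabs ?gt0 ?decreasing_blocks // => /andP[_ perm1] /andP[_ perm2].
suffices -> : Q1 = Q2 by [].
have memQ Q0 m : partition Q0 C -> perm_eq (flatten T2) (blocks Q0 ++ nseq m set0) ->
    Q0 = [set X in flatten T2 | X != set0].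
  case/and3P => _ _ nQ0 perm0; apply/setP => X.
  rewrite inE (perm_mem perm0) mem_cat mem_sort mem_enum mem_nseq.
  have [->|_] := eqVneq X set0; first by rewrite andbF (negbTE nQ0).
  by rewrite andbF orbF andbT.
by rewrite (memQ Q1 _ partQ1 perm1) -(memQ Q2 _ partQ2 perm2).
Qed.

Lemma sum_all_tabs n (F : seq nat -> nat) : #|C| < n ->
  \sum_(x <- map shape (all_tabs n)) F x =
  \sum_(Q : {set {set letter k}} | partition Q C)
     \sum_(x <- iter #|Q| up [:: row_shape (n - #|Q|)]) F x.
Proof.
move=> lt_Cn; rewrite big_map big_allpairs_dep big_enum /=.
apply: eq_big => [Q|Q]; rewrite inE // => partQ.
have gt0 : 0 < n - #|Q|.
  by move/partition_card_le: partQ; rewrite subn_gt0; lia.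
by rewrite -{2}(size_blocks Q) -shape_tabs // big_map.
Qed.

End Content.

(** * The bijection *)

Lemma dotp_all_tabs k (C D : {set letter k}) n :
  #|C| < n -> #|D| < n -> #|C| + #|D| <= n ->
  dotp (map shape (all_tabs C n)) (map shape (all_tabs D n)) =
  \sum_(P : {set {set letter k}} | partition P C)
    \sum_(Q : {set {set letter k}} | partition Q D) npinj #|P| #|Q|.
Proof.
move=> ltC ltD leCD; rewrite /dotp sum_all_tabs //; apply: eq_bigr => P partP.
under eq_bigr do rewrite sum_all_tabs //.
rewrite exchange_big /=; apply: eq_bigr => Q partQ.
rewrite -(@dotp_rows #|P| #|Q| n) //.
have := partition_card_le partP; have := partition_card_le partQ; lia.
Qed.

Lemma bijective_enumeration (A : finType) (B : eqType) (p : pred B) (L : seq B) :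
  uniq L -> L =i p -> size L = #|A| -> exists f : A -> {x | p x}, bijective f.
Proof.
move=> uniqL memL sizeL.
pose L' : seq {x | p x} := pmap insub L.
have sizeL' : size L' = #|A|.
  rewrite size_pmap_sub -sizeL; apply/eqP; rewrite -all_count.
  by apply/allP => x; rewrite memL.
have uniqL' : uniq L' by apply: pmap_sub_uniq.
have ltL' y : index y L' < size L'.
  by rewrite index_mem mem_pmap_sub memL; apply: (valP y).
exists (fun a => tnth (in_tuple L') (cast_ord (esym sizeL') (enum_rank a))).
exists (fun y => enum_val (cast_ord sizeL' (Ordinal (ltL' y)))) => [a|y].
  rewrite -[RHS]enum_rankK; congr enum_val; apply: val_inj => /=.
  rewrite (tnth_nth (tnth (in_tuple L') (cast_ord (esym sizeL') (enum_rank a)))).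
  by rewrite index_uniq //= sizeL'.
by rewrite enum_valK cast_ordK (tnth_nth y) /= nth_index // -index_mem.
Qed.

Lemma letter_pos_inj_unbarred k : {in unbarred k &, injective (@letter_pos k)}.
Proof.
by move=> _ _ /imsetP[i _ ->] /imsetP[j _ ->] /= /val_inj->.
Qed.

Lemma letter_pos_inj_barred k : {in barred k &, injective (@letter_pos k)}.
Proof.
by move=> _ _ /imsetP[i _ ->] /imsetP[j _ ->] /= /val_inj->.
Qed.

Theorem theorem6p3 (k n : nat) (hk : 0 < k) (hn : 2 * k <= n) :
  exists f : set_partition k -> tableau_pair k n, bijective f.
Proof.
have card_b : #|barred k| = k by rewrite card_imset ?card_ord // => i j [].
have card_u : #|unbarred k| = k by rewrite card_imset ?card_ord // => i j [].
have lt_kn : k < n by lia.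
pose AT := all_tabs (barred k) n; pose AS := all_tabs (unbarred k) n.
pose L := [seq TS <- [seq (T, U) | T <- AT, U <- AS] | shape TS.1 == shape TS.2].
apply: (@bijective_enumeration _ _ _ L).
- apply/filter_uniq/allpairs_uniq => [||[T U] [T' U'] _ _ //].
    by apply: uniq_all_tabs; rewrite ?card_b //; apply: letter_pos_inj_barred.
  by apply: uniq_all_tabs; rewrite ?card_u //; apply: letter_pos_inj_unbarred.
- move=> [T U]; rewrite mem_filter /= [LHS]/=.
  rewrite [in RHS]unfold_in /=; case: eqP => //= eq_sh.
  rewrite (_ : _ \in _ = (T \in AT) && (U \in AS)); last first.
    apply/allpairsP/andP => [[[T' U'] /= [? ? [-> ->]]]|[? ?]] //.
    by exists (T, U).
  rewrite /AT /AS (mem_all_tabs (@letter_pos_inj_barred k)) ?card_b //.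
  rewrite (mem_all_tabs (@letter_pos_inj_unbarred k)) ?card_u //.
  by rewrite -eq_sh; case: (_ == n).
have -> : size L = dotp (map shape AT) (map shape AS).
  rewrite /dotp size_filter -sum1_count big_mkcond big_allpairs big_map.
  apply: eq_bigr => T _; rewrite big_map; apply: eq_bigr => U _ /=.
  by case: (_ == _).
rewrite dotp_all_tabs ?card_b ?card_u //; last by lia.
rewrite card_sig setUC -card_partitions_disjointU.
  by apply: eq_card => P; rewrite inE.
rewrite -setI_eq0; apply/eqP/setP => a; rewrite !inE.
by apply/negP => /andP[/imsetP[i _ ->] /imsetP[]].
Qed.
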